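(* Let $N=\{1,\dots,n\}$ be a set of $n\ge 1$ agents and $M$ a set of $m$ indivisible goods, and write $m=kn+r$ with $k=\lfloor m/n\rfloor$ and $0\le r<n$. Let $\mathcal{X}$ be a mechanism defined on all profiles of strict leveled preferences over the subsets of $M$. Then $\mathcal{X}$ satisfies EFX, Pareto optimality, truthfulness, non-bossiness and neutrality if and only if $\mathcal{X}$ is a serial dictatorship with quotas (for some permutation of the agents) in which each of the first $n-r$ agents in the picking order has quota $\lfloor m/n\rfloor$ and each of the last $r$ agents in the picking order has quota $\lfloor m/n\rfloor+1$.
   Context: A strict leveled preference of an agent $i$ is a strict linear order $\succ_i$ on $2^M$ such that $S\succ_i T$ whenever $|S|>|T|$; write $S\succeq_i T$ if $S\succ_i T$ or $S=T$. An allocation is a tuple $(A_1,\dots,A_n)$ of pairwise disjoint (possibly empty) subsets of $M$ with union $M$. A mechanism is a deterministic map $\mathcal{X}$ from preference profiles $\succ=(\succ_1,\dots,\succ_n)$ to allocations (no payments); $\mathcal{X}_i(\succ)$ is agent $i$'s bundle. EFX: for each profile $\succ$, with $A=\mathcal{X}(\succ)$, $A_i\succeq_i A_j\setminus\{g\}$ for all $i,j\in N$ and $g\in A_j$. Pareto optimality: for each profile $\succ$ there is no allocation $B$ with $B_i\succeq_i \mathcal{X}_i(\succ)$ for all $i$ and $B_i\succ_i\mathcal{X}_i(\succ)$ for some $i$. Truthfulness (strategyproofness): $\mathcal{X}_i(\succ)\succeq_i\mathcal{X}_i(\succ_i',\succ_{-i})$ for every profile $\succ$, agent $i$ and alternative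 strict leveled preference $\succ_i'$. Non-bossiness: if $\mathcal{X}_i(\succ_i',\succ_{-i})=\mathcal{X}_i(\succ)$ then $\mathcal{X}(\succ_i',\succ_{-i})=\mathcal{X}(\succ)$, i.e. no agent can change the allocation by a deviating report without changing her own bundle. Neutrality: the mechanism does not depend on the labeling of the goods, i.e. for every permutation $\pi$ of $M$, if every agent's preference is relabeled by $\pi$ (so that $\pi(S)\succ_i^{\pi}\pi(T)\iff S\succ_i T$), then $\mathcal{X}_i(\succ^{\pi})=\pi(\mathcal{X}_i(\succ))$ for all $i$. Serial dictatorship with quotas: it is specified by a permutation (picking order) $\sigma_1,\dots,\sigma_n$ of the agents and nonnegative integer quotas $q_1,\dots,q_n$ with $\sum_{t=1}^n q_t=m$; for $t=1,\dots,n$ in turn, agent $\sigma_t$ receives her most preferred bundle of exactly $q_t$ goods among the goods not yet taken by $\sigma_1,\dots,\sigma_{t-1}$. *)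

(* Defs.v *)
From HB Require Import structures.
From mathcomp Require Import all_boot all_fingroup.

Set Implicit Arguments.
Unset Strict Implicit.
Unset Printing Implicit Defensive.

(* A relation on bundles is stored as its (finite) graph and its axioms as a
   boolean, so that Leibniz equality of preferences is extensional equality and
   a mechanism can depend only on the order itself. *)
Definition strict_leveled (M : finType) (R : {set {set M} * {set M}}) : bool :=
  [&& [forall S, (S, S) \notin R],
      [forall S, forall T, forall U,
         ((S, T) \in R) && ((T, U) \in R) ==> ((S, U) \in R)],
      [forall S, forall T, (S != T) ==> ((S, T) \in R) || ((T, S) \in R)]
    & [forall S : {set M}, forall T : {set M},
         (#|T| < #|S|) ==> ((S, T) \in R)]].

Record pref (M : finType) : Type := Pref {
  pref_graph :> {set {set M} * {set M}};
  pref_graphP : strict_leveled pref_graph }.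

HB.instance Definition _ (M : finType) := [isSub for @pref_graph M].
HB.instance Definition _ (M : finType) := [Finite of pref M by <:].

Definition prefers (M : finType) (p : pref M) : rel {set M} :=
  fun S T => (S, T) \in pref_graph p.

Definition wprefers (M : finType) (p : pref M) : rel {set M} :=
  fun S T => prefers p S T || (S == T).

Definition profile (n : nat) (M : finType) : Type := {ffun 'I_n -> pref M}.

Definition deviate (n : nat) (M : finType) (P : profile n M) (i : 'I_n)
    (p : pref M) : profile n M :=
  [ffun j => if j == i then p else P j].

Definition is_allocation (n : nat) (M : finType) (A : {ffun 'I_n -> {set M}}) :
    bool :=
  [forall i, forall j, (i != j) ==> [disjoint A i & A j]]
  && (\bigcup_i A i == [set: M]).

Record allocation (n : nat) (M : finType) : Type := Allocation {
  bundle :> {ffun 'I_n -> {set M}};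
  bundleP : is_allocation bundle }.

HB.instance Definition _ (n : nat) (M : finType) := [isSub for @bundle n M].
HB.instance Definition _ (n : nat) (M : finType) :=
  [Finite of allocation n M by <:].

Definition mechanism (n : nat) (M : finType) : Type :=
  profile n M -> allocation n M.

Definition EFX (n : nat) (M : finType) (X : mechanism n M) : Prop :=
  forall (P : profile n M) (i j : 'I_n) (g : M),
    g \in X P j -> wprefers (P i) (X P i) (X P j :\ g).

Definition pareto_optimal (n : nat) (M : finType) (X : mechanism n M) : Prop :=
  forall P : profile n M,
    ~ exists B : allocation n M,
        (forall i : 'I_n, wprefers (P i) (B i) (X P i)) /\
        (exists i : 'I_n, prefers (P i) (B i) (X P i)).

Definition truthful (n : nat) (M : finType) (X : mechanism n M) : Prop :=
  forall (P : profile n M) (i : 'I_n) (p : pref M),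
    wprefers (P i) (X P i) (X (deviate P i p) i).

Definition non_bossy (n : nat) (M : finType) (X : mechanism n M) : Prop :=
  forall (P : profile n M) (i : 'I_n) (p : pref M),
    X (deviate P i p) i = X P i -> X (deviate P i p) = X P.

(* [q] is the image of [p] under the relabeling [s] of the goods; for every [p]
   and [s] there is exactly one such [q]. *)
Definition relabeled (M : finType) (s : {perm M}) (p q : pref M) : Prop :=
  forall S T : {set M}, prefers q (s @: S) (s @: T) = prefers p S T.

Definition neutral (n : nat) (M : finType) (X : mechanism n M) : Prop :=
  forall (s : {perm M}) (P Q : profile n M),
    (forall i : 'I_n, relabeled s (P i) (Q i)) ->
    forall i : 'I_n, X Q i = s @: X P i.

Definition most_preferred (M : finType) (p : pref M) (F : {set M}) (k : nat)
    (B : {set M}) : Prop :=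
  [/\ B \subset F, #|B| = k &
      forall S : {set M}, S \subset F -> #|S| = k -> wprefers p B S].

(* Positions in the picking order are numbered from 0: [s t] is the agent who
   picks at position [t], and [q t] is the quota of that position. *)
Definition serial_dictatorship (n : nat) (M : finType) (s : {perm 'I_n})
    (q : 'I_n -> nat) (X : mechanism n M) : Prop :=
  \sum_(t < n) q t = #|M| /\
  forall (P : profile n M) (t : 'I_n),
    most_preferred (P (s t)) (~: \bigcup_(u < n | u < t) X P (s u)) (q t)
      (X P (s t)).

(* Main.v *)
(** The forward direction follows Svensson's argument for house allocation.
    Truthfulness and non-bossiness give Maskin monotonicity, so by neutrality the
    outcome at one profile [P0] dictates, up to a relabeling of the goods, the
    outcome at every profile whose lower contour sets contain the relabeled ones.
    For [P0] let all agents share a lexicographic order on bundles of equal size.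
    The bundles at [P0] are consecutive blocks of goods: if an agent owned goods
    ranked above and below a good of another agent, two different relabelings
    would force different outcomes at one profile.  At an arbitrary profile,
    relabel the goods so that the blocks become the successive picks; the
    lexicographic order then ranks above a block only bundles that meet an earlier
    block, so monotonicity applies.  EFX at [P0] fixes the quotas. *)
Require Import Defs.
From mathcomp Require Import all_boot all_fingroup.
From mathcomp Require Import zify.

Set Implicit Arguments.
Unset Strict Implicit.
Unset Printing Implicit Defensive.

(** * Leveled preferences *)

Section Preferences.

Variable M : finType.
Implicit Types (p : pref M) (S T A B F : {set M}).

Lemma prefers_irr p S : prefers p S S = false.
Proof.
case: p => R HR; rewrite /prefers /=; case/and4P: HR => /forallP/(_ S) H _ _ _.
exact: negbTE.
Qed.

Lemma prefers_trans p : transitive (prefers p).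
Proof.
case: p => R HR T S U; rewrite /prefers /=; case/and4P: HR => _ H _ _ ST TU.
by move/forallP/(_ S)/forallP/(_ T)/forallP/(_ U): H; rewrite ST TU.
Qed.

Lemma prefers_total p S T : S != T -> prefers p S T || prefers p T S.
Proof.
case: p => R HR ST; rewrite /prefers /=; case/and4P: HR => _ _ H _.
by move/forallP/(_ S)/forallP/(_ T): H; rewrite ST.
Qed.

Lemma prefers_card p S T : #|T| < #|S| -> prefers p S T.
Proof.
case: p => R HR ST; rewrite /prefers /=; case/and4P: HR => _ _ _ H.
by move/forallP/(_ S)/forallP/(_ T): H; rewrite ST.
Qed.

Lemma prefers_asym p S T : prefers p S T -> prefers p T S = false.
Proof.
by move=> ST; apply/negP => TS; move: (prefers_trans ST TS); rewrite prefers_irr.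
Qed.

Lemma prefers_leq_card p S T : prefers p S T -> #|T| <= #|S|.
Proof.
by move=> ST; rewrite leqNgt; apply/negP => /(prefers_card p); rewrite prefers_asym.
Qed.

Lemma wprefers_leq_card p S T : wprefers p S T -> #|T| <= #|S|.
Proof. by case/orP => [/prefers_leq_card|/eqP->]. Qed.

Lemma wprefers_anti p S T : wprefers p S T -> wprefers p T S -> S = T.
Proof.
case/orP=> [ST|/eqP //]; case/orP=> [TS|/eqP //].
by rewrite (prefers_asym ST) in TS.
Qed.

Lemma most_preferred_uniq p F k A B :
  most_preferred p F k A -> most_preferred p F k B -> A = B.
Proof.
move=> [AF Ak Amax] [BF Bk Bmax].
by apply: (@wprefers_anti p); [apply: Amax | apply: Bmax].
Qed.

(** The maximiser is found by counting the bundles that a candidate beats: by transitivity, a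
    candidate preferred to [B] beats everything [B] beats, and [B] as well. *)
Lemma most_preferred_ex p F S : S \subset F ->
  exists B, most_preferred p F #|S| B.
Proof.
move=> SF; pose score (U : {set M}) := #|[set T | prefers p U T]|.
pose cand (U : {set M}) := (U \subset F) && (#|U| == #|S|).
have candS : cand S by rewrite /cand SF eqxx.
case: (arg_maxnP score candS) => B /andP[BF /eqP BS] Bmax; exists B; split=> // U UF US.
rewrite /wprefers; have [->|BU] := eqVneq B U; first by rewrite orbT.
have /orP[->//|UB] := prefers_total p BU.
have := Bmax U; rewrite /cand UF US eqxx => /(_ isT); rewrite /= leqNgt => /negP[].
apply: proper_card; apply/properP; split.
  by apply/subsetP => T; rewrite !inE; apply: prefers_trans.
by exists B; rewrite !inE ?prefers_irr.
Qed.

Lemma pref_of_rel (R : rel {set M}) :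
  irreflexive R -> transitive R -> (forall S T, S != T -> R S T || R T S) ->
  (forall S T, #|T| < #|S| -> R S T) -> exists p, prefers p =2 R.
Proof.
move=> Rirr Rtr Rtot Rcard.
have HR : strict_leveled [set ST | R ST.1 ST.2].
  apply/and4P; split; apply/forallP => S.
  - by rewrite inE /= Rirr.
  - apply/forallP => T; apply/forallP => U; rewrite !inE /=.
    by apply/implyP => /andP[]; apply: Rtr.
  - by apply/forallP => T; rewrite !inE /=; apply/implyP/Rtot.
  - by apply/forallP => T; rewrite !inE /=; apply/implyP/Rcard.
by exists (Pref HR) => S T; rewrite /prefers inE.
Qed.

(** Sizes are compared first, then scores, then an arbitrary enumeration index that breaks the
    remaining ties. *)
Lemma pref_of_score (u : {set M} -> nat) :
  exists p, forall S T, #|S| = #|T| -> u T < u S -> prefers p S T.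
Proof.
pose key S : nat := enum_rank S.
pose R S T := [|| #|T| < #|S|, (#|T| == #|S|) && (u T < u S)
                | [&& #|T| == #|S|, u T == u S & key T < key S]].
have [||||p pR] := @pref_of_rel R.
- by move=> S; rewrite /R !ltnn !andbF.
- by move=> T S U; rewrite /R; lia.
- move=> S T /eqP ST.
  have : key S <> key T by move=> /val_inj/enum_rank_inj.
  by rewrite /R; lia.
- by move=> S T; rewrite /R => ->.
by exists p => S T ST uST; rewrite pR /R ST eqxx uST orbT.
Qed.

Lemma relabeled_ex (s : {perm M}) p : exists q, relabeled s q p.
Proof.
have [||||q qE] := @pref_of_rel (fun S T => prefers p (s @: S) (s @: T)).
- by move=> S; rewrite prefers_irr.
- by move=> T S U; apply: prefers_trans.
- move=> S T ST; apply: prefers_total.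
  by rewrite (inj_eq (imset_inj perm_inj)).
- by move=> S T ST; apply: prefers_card; rewrite !card_imset //; apply: perm_inj.
by exists q => S T; rewrite qE.
Qed.

(** * Permutations of goods acting on bundles *)

Lemma imset_perm_on S (s : {perm M}) : perm_on S s -> s @: S = S.
Proof.
move=> sS; apply/eqP; rewrite eqEcard card_imset ?leqnn ?andbT; last exact: perm_inj.
by apply/subsetP => _ /imsetP[x xS ->]; rewrite perm_closed.
Qed.

Lemma imset_tperm_in S x y : x \in S -> y \in S -> tperm x y @: S = S.
Proof.
move=> xS yS; apply: imset_perm_on; apply: subset_trans (tperm_on x y) _.
by apply/subsetP => z /set2P[] ->.
Qed.

Lemma imset_tperm_notin S x y : x \notin S -> y \notin S -> tperm x y @: S = S.
Proof.
move=> xS yS; rewrite -[RHS]imset_id; apply: eq_in_imset => z zS.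
by rewrite tpermD //; apply: contraTneq zS => <-.
Qed.

Lemma imset_tperm S x y : x \in S -> y \notin S ->
  tperm x y @: S = y |: S :\ x.
Proof.
move=> xS yS; rewrite -{1}(setD1K xS) imsetU1 tpermL imset_tperm_notin //.
  by rewrite !inE eqxx.
by rewrite !inE (negbTE yS) andbF.
Qed.

(** Induction on the size of [S :\: T]: transposing a good of [S] outside [T] with one of [T]
    outside [S] lowers it. Support inside [F] will keep goods already picked in place. *)
Lemma ex_perm_imset F S T : S \subset F -> T \subset F -> #|S| = #|T| ->
  exists2 s : {perm M}, perm_on F s & s @: S = T.
Proof.
move=> + TF; elim: {S}_.+1 {-2}S (ltnSn #|S :\: T|) => // k IHk S Sk SF ST.
have [SsubT|] := boolP (S \subset T).
  exists 1%g; first exact: perm_on1.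
  have/eqP-> : S == T by rewrite eqEcard SsubT ST leqnn.
  by rewrite -[RHS]imset_id; apply: eq_imset => x; rewrite perm1.
case/subsetPn => x xS xT.
have [y yT yS] : exists2 y, y \in T & y \notin S.
  apply/subsetPn; apply/negP => TS.
  have/eqP TeS : T == S by rewrite eqEcard TS ST leqnn.
  by rewrite TeS xS in xT.
have ST' := imset_tperm xS yS.
have [||| s sF sS] := IHk (tperm x y @: S).
- rewrite ltnS in Sk; apply: leq_trans Sk; apply: proper_card.
  have xy : x != y by apply: contraNneq xT => ->.
  apply/properP; split; last by exists x; rewrite ?ST' !inE ?xS ?xT ?(negbTE xy) ?eqxx.
  apply/subsetP => z; rewrite ST' !inE => /andP[zT].
  by case/orP => [/eqP zy|/andP[_ ->]]; [rewrite zy yT in zT | rewrite zT].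
- apply/subsetP => z; rewrite ST' !inE.
  case/orP => [/eqP->|/andP[_ zS]]; [exact: (subsetP TF) | exact: (subsetP SF)].
- by rewrite card_imset //; apply: perm_inj.
exists (tperm x y * s)%g.
  apply: perm_onM sF; apply: subset_trans (tperm_on x y) _.
  by apply/subsetP => z /set2P[] ->; [apply: (subsetP SF) | apply: (subsetP TF)].
by rewrite -sS -imset_comp; apply: eq_imset => z; rewrite /= permM.
Qed.

End Preferences.

(** * Allocations as partitions of the goods *)

Section Allocations.

Variables (n : nat) (M : finType).
Implicit Types (A B : allocation n M).

Lemma bundle_inj A i j g : g \in A i -> g \in A j -> i = j.
Proof.
case: A => A /= /andP[/forallP/(_ i)/forallP/(_ j) dA _] gi gj.
by apply/eqP; apply: contraLR gj => /(implyP dA)/disjointFr/(_ gi) ->.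
Qed.

Lemma bundle_cover A g : exists i, g \in A i.
Proof.
case: A => A /= /andP[_ /eqP cA].
have : g \in \bigcup_i A i by rewrite cA inE.
by case/bigcupP => i _; exists i.
Qed.

Lemma sum_card_bundle A : \sum_i #|A i| = #|M|.
Proof.
under eq_bigr => i _ do rewrite -sum1_card big_mkcond /=.
rewrite exchange_big /= -sum1_card; apply: eq_bigr => g _.
have [i gi] := bundle_cover A g.
rewrite (bigD1 i) //= gi big1 ?addn0 // => j ji.
by rewrite ifN //; apply: contraNN ji => gj; rewrite (bundle_inj gi gj).
Qed.

Lemma bundle_sub_remaining A (s : {perm 'I_n}) (t t' : 'I_n) :
  t <= t' -> A (s t') \subset ~: \bigcup_(u < n | u < t) A (s u).
Proof.
move=> tt'; apply/subsetP => g gA; rewrite inE; apply/bigcupP => -[u ut gu].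
by have /perm_inj tu := bundle_inj gA gu; rewrite tu leqNgt ut in tt'.
Qed.

End Allocations.

(** * Serial dictatorships satisfy the axioms *)

Section SerialDictatorship.

Variables (n : nat) (M : finType) (s : {perm 'I_n}) (q : 'I_n -> nat).
Variable X : mechanism n M.
Hypothesis sdX : serial_dictatorship s q X.
Implicit Types (P Q : profile n M) (t : 'I_n) (S : {set M}).

Lemma sd_card P t : #|X P (s t)| = q t.
Proof. by have [_ /(_ P t)[]] := sdX. Qed.

Lemma sd_best P t S : S \subset ~: (\bigcup_(u < n | u < t) X P (s u)) ->
  #|S| = q t -> wprefers (P (s t)) (X P (s t)) S.
Proof. by have [_ /(_ P t)[_ _]] := sdX; apply. Qed.

Lemma sd_remaining_congr (A B : allocation n M) (t : 'I_n) :
  (forall u : 'I_n, u < t -> A (s u) = B (s u)) ->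
  \bigcup_(u < n | u < t) A (s u) = \bigcup_(u < n | u < t) B (s u).
Proof. by move=> AB; apply: eq_bigr => u /AB. Qed.

Lemma ord_strong_ind (R : 'I_n -> Prop) :
  (forall t : 'I_n, (forall u : 'I_n, u < t -> R u) -> R t) -> forall t, R t.
Proof.
move=> IH t; elim: {t}_.+1 {-2}t (ltnSn t) => // k IHk t tk.
by apply: IH => u ut; apply: IHk; apply: leq_trans ut _.
Qed.

(** The first alternative serves truthfulness, where agents before the deviator keep their reports;
    with the second, non-bossiness passes over the deviator, whose bundle is unchanged. *)
Lemma sd_ext P Q (t : 'I_n) : (forall u : 'I_n, u <= t ->
    P (s u) = Q (s u) \/ X P (s u) = X Q (s u)) ->
  forall u : 'I_n, u <= t -> X P (s u) = X Q (s u).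
Proof.
move=> PQ; elim/ord_strong_ind => u IHu ut.
have [PQu|//] := PQ u ut.
have XE : forall v : 'I_n, v < u -> X P (s v) = X Q (s v).
  by move=> v vu; apply: IHu => //; apply: leq_trans (ltnW vu) ut.
have [_ sd] := sdX.
have := sd P u; rewrite PQu (sd_remaining_congr XE).
by move/most_preferred_uniq; apply; apply: sd.
Qed.

Lemma sd_truthful : truthful X.
Proof.
move=> P i p; rewrite -[i](permKV s); set t := (s^-1)%g i.
apply: sd_best; last exact: sd_card.
have XE (u : 'I_n) : u < t -> X P (s u) = X (deviate P (s t) p) (s u).
  move=> ut; apply: (@sd_ext _ _ u) => // v vu; left.
  rewrite ffunE ifN // (inj_eq perm_inj) -val_eqE /=.
  by rewrite ltn_eqF //; apply: leq_ltn_trans vu ut.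
by rewrite (sd_remaining_congr XE) bundle_sub_remaining.
Qed.

Lemma sd_non_bossy : non_bossy X.
Proof.
move=> P i p XE; apply: val_inj; apply/ffunP => j.
rewrite -[j](permKV s); apply: (@sd_ext _ _ ((s^-1)%g j)) => // u _.
by rewrite ffunE; case: eqP => [->|_]; [right | left].
Qed.

Lemma sd_neutral : neutral X.
Proof.
move=> p P Q PQ i; rewrite -[i](permKV s); set t := (s^-1)%g i.
elim/ord_strong_ind: t => t IHt.
have [_ sd] := sdX; apply: most_preferred_uniq (sd Q t) _.
have [sub cardE best] := sd P t.
have FE : ~: (\bigcup_(u < n | u < t) X Q (s u)) =
          p @: (~: (\bigcup_(u < n | u < t) X P (s u))).
  under eq_bigr => u ut do rewrite IHt //.
  rewrite -[p @: ~: _]setCK; congr (~: _); apply/setP => g.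
  rewrite -[g](permKV p); set h := (p^-1)%g g.
  rewrite !inE mem_imset ?inE ?negbK; last exact: perm_inj.
  apply/bigcupP/bigcupP => -[u ut gu]; exists u => //.
    by move: gu; rewrite mem_imset //; apply: perm_inj.
  by rewrite mem_imset //; apply: perm_inj.
rewrite FE; split; first exact: imsetS.
  by rewrite card_imset //; apply: perm_inj.
move=> S SF Sq.
(* Every competing bundle is the image of its preimage, so optimality transfers from [P]. *)
have SE : S = p @: ((p^-1)%g @: S).
  by rewrite -imset_comp -[LHS]imset_id; apply: eq_imset => x; rewrite /= permKV.
move: SF Sq; rewrite {}SE; move: (_ @: S) => {}S SF Sq.
rewrite /wprefers PQ (inj_eq (imset_inj perm_inj)); apply: best.
  apply/subsetP => g gS; have := subsetP SF (p g).
  by rewrite !mem_imset; try exact: perm_inj; apply.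
by rewrite -Sq card_imset //; apply: perm_inj.
Qed.

(** In a leveled order a weak improvement cannot shrink a bundle, and all sizes sum to the number of
    goods, so sizes agree. Each dictator in turn then already holds the best bundle of that size. *)
Lemma sd_pareto_optimal : pareto_optimal X.
Proof.
move=> P [B [BX [i iB]]].
have cardE j : #|X P j| = #|B j|.
  have le_card l : true -> #|X P l| <= #|B l| ?= iff (#|X P l| == #|B l|).
    by split; first exact: wprefers_leq_card (BX l).
  have [_] := leqif_sum le_card; rewrite !sum_card_bundle eqxx.
  by move/esym/forallP/(_ j)/eqP.
suff BE t : B (s t) = X P (s t).
  by have := iB; rewrite -[i](permKV s) BE prefers_irr.
elim/ord_strong_ind: t => t IHt.
apply: (wprefers_anti (BX (s t))); apply: sd_best; last by rewrite -cardE sd_card.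
by rewrite -(sd_remaining_congr IHt) bundle_sub_remaining.
Qed.

Lemma sd_EFX (k c : nat) : (forall t : 'I_n, t < c -> q t = k) ->
  (forall t : 'I_n, c <= t -> q t = k.+1) -> EFX X.
Proof.
move=> qlo qhi P i j g; rewrite -[i](permKV s) -[j](permKV s).
move: (_ i) (_ j) => t u gX.
have cardD : #|X P (s u)| = #|X P (s u) :\ g|.+1 by rewrite (cardsD1 g) gX.
rewrite sd_card in cardD.
have [lt|] := ltnP #|X P (s u) :\ g| (q t).
  by rewrite /wprefers prefers_card ?sd_card.
(* Here [q t < q u], so [t] lies before the cut [c] and [u] after it: what remains of the bundle of
   [u] was available to [t] and has size [q t]. *)
move=> ge; have [tc|ct] := ltnP t c; last first.
  by have := qhi t ct; have := qlo u; have := qhi u; lia.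
have cu : c <= u by rewrite leqNgt; apply/negP => /qlo; rewrite qlo // in ge; lia.
apply: sd_best; last by move: cardD ge; rewrite (qlo t) // (qhi u) //; lia.
apply: subset_trans (subsetDl _ _) _; apply: bundle_sub_remaining.
exact: leq_trans (ltnW tc) cu.
Qed.

End SerialDictatorship.

(** * Maskin monotonicity and neutrality *)

(** Truthfulness is used in both directions, at [P] and at the deviated profile. Together they fix
    the bundle of [i], and non-bossiness then fixes the rest. *)
Lemma monotone_step (n : nat) (M : finType) (X : mechanism n M)
    (P : profile n M) (i : 'I_n) (p : pref M) :
  truthful X -> non_bossy X ->
  (forall S, prefers (P i) (X P i) S -> prefers p (X P i) S) ->
  X (deviate P i p) = X P.
Proof.
move=> tX nbX lower; apply: (nbX P i p).
have := tX (deviate P i p) i (P i).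
have -> : deviate (deviate P i p) i (P i) = P.
  by apply/ffunP => j; rewrite !ffunE; case: eqP => [->|].
rewrite ffunE eqxx => back.
have /orP[/lower fwd|/eqP //] := tX P i p.
by apply: (wprefers_anti back); rewrite /wprefers fwd.
Qed.

Lemma maskin_monotone (n : nat) (M : finType) (X : mechanism n M)
    (P Q : profile n M) :
  truthful X -> non_bossy X ->
  (forall i S, prefers (P i) (X P i) S -> prefers (Q i) (X P i) S) ->
  X Q = X P.
Proof.
move=> tX nbX lower.
(* Switch the agents from [P] to [Q] one at a time; the outcome stays [X P], so the hypothesis
   applies at each switch. *)
pose mix k : profile n M := [ffun j : 'I_n => if j < k then Q j else P j].
have XE k : k <= n -> X (mix k) = X P.
  elim: k => [_|k IHk kn]; first by congr X; apply/ffunP => j; rewrite ffunE.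
  have <- : deviate (mix k) (Ordinal kn) (Q (Ordinal kn)) = mix k.+1.
    apply/ffunP => j; rewrite !ffunE ltnS -val_eqE /=.
    case: ltngtP => //= jk; congr (Q _); exact: val_inj.
  rewrite monotone_step //; first by apply: IHk; apply: ltnW.
  by move=> S; rewrite IHk ?(ltnW kn) // ffunE ltnn; apply: lower.
by rewrite -(XE n) //; congr X; apply/ffunP => j; rewrite ffunE ltn_ord.
Qed.

(** Pull [Q] back along [s], apply monotonicity from [P] to the pulled-back profile, and return by
    neutrality. *)
Lemma neutral_maskin (n : nat) (M : finType) (X : mechanism n M)
    (P Q : profile n M) (s : {perm M}) :
  truthful X -> non_bossy X -> neutral X ->
  (forall i S, prefers (P i) (X P i) S ->
               prefers (Q i) (s @: X P i) (s @: S)) ->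
  forall i, X Q i = s @: X P i.
Proof.
move=> tX nbX ntX lower i.
have /fin_all_exists [Q' Q'Q] := fun j => relabeled_ex s (Q j).
have Q'fE j : relabeled s ([ffun j => Q' j] j) (Q j) by rewrite ffunE.
rewrite (ntX s [ffun j => Q' j] Q Q'fE) (maskin_monotone (P := P)) // => j S /lower.
by rewrite ffunE Q'Q.
Qed.

(* At a profile where [i] ranks the bundles [y] (x with b for c) and [z] (x with
   b for a) as y > z > ..., [j] ranks its counterparts as z > y > ... and every
   other agent tops her bundle in x = X P, relabeling by the transposition (b c)
   forces the outcome y, while relabeling by (a b) forces the outcome z. *)
Lemma no_double_swap (n : nat) (M : finType) (X : mechanism n M)
    (P : profile n M) (i j : 'I_n) (a b c : M) :
  truthful X -> non_bossy X -> neutral X -> i != j ->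
  a \in X P i -> c \in X P i -> b \in X P j -> a != c ->
  prefers (P i) (tperm c b @: X P i) (X P i) ->
  prefers (P j) (tperm b a @: X P j) (X P j) -> False.
Proof.
move=> tX nbX ntX ij ai ci bj ac; set x := X P => yx zx.
have notin l l' g : g \in x l -> l != l' -> g \notin x l'.
  by move=> gl; apply: contraNN => gl'; rewrite (bundle_inj gl gl').
have bi : b \notin x i by apply: notin bj _; rewrite eq_sym.
have aj : a \notin x j by apply: notin ai _.
have cj : c \notin x j by apply: notin ci _.
have cardp (s : {perm M}) (S : {set M}) : #|s @: S| = #|S|.
  by rewrite card_imset //; apply: perm_inj.
have injp (s : {perm M}) := imset_inj (@perm_inj _ s).
pose score l (S : {set M}) := if l == i then
    (S == tperm c b @: x i) * 2 + (S == tperm b a @: x i)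
  else if l == j then (S == tperm b a @: x j) * 2 + (S == tperm c b @: x j)
  else (S == x l) : nat.
have /fin_all_exists [Q QP] := fun l => pref_of_score (score l).
pose Qf : profile n M := [ffun l => Q l].
have lift l (S T : {set M}) : #|T| <= #|S| -> score l T < score l S -> prefers (Qf l) S T.
  rewrite leq_eqVlt ffunE => /orP[/eqP TS|TS _]; first exact: QP.
  exact: prefers_card.
have ne l (S : {set M}) : prefers (P l) (x l) S -> S != x l.
  by move=> xS; apply: contraTneq xS => ->; rewrite prefers_irr.
have other (s : {perm M}) l (S : {set M}) : l != i -> l != j -> s @: x l = x l ->
    prefers (P l) (x l) S -> prefers (Qf l) (s @: x l) (s @: S).
  move=> li lj sx xS; apply: lift; first by rewrite !cardp (prefers_leq_card xS).
  rewrite /score (negbTE li) (negbTE lj) sx eqxx -{1}sx (inj_eq (injp s)).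
  by rewrite (negbTE (ne _ _ xS)).
have fix_b_c l : l != i -> l != j -> tperm c b @: x l = x l.
  by move=> li lj; apply: imset_tperm_notin; [apply: notin ci _ | apply: notin bj _];
    rewrite eq_sym.
have fix_a_b l : l != i -> l != j -> tperm b a @: x l = x l.
  by move=> li lj; apply: imset_tperm_notin; [apply: notin bj _ | apply: notin ai _];
    rewrite eq_sym.
have ab : a != b by apply: contraNneq bi => <-.
have cb : c != b by apply: contraNneq bi => <-.
(* The bundle scoring above an agent's target is fixed by the relabeling in use, so it could only be
   the image of itself; but it is preferred to that agent's bundle in [x] and thus not in the lower
   contour set. *)
have fix_y : tperm b a @: (tperm c b @: x i) = tperm c b @: x i.
  by apply: imset_tperm_in; rewrite imset_tperm // !inE ?eqxx // ac ai orbT.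
have fix_z : tperm c b @: (tperm b a @: x j) = tperm b a @: x j.
  apply: imset_tperm_notin; rewrite imset_tperm // !inE ?eqxx.
    by rewrite (negbTE cj) andbF orbF eq_sym.
  by rewrite eq_sym (negbTE ab).
have Xy : X Qf i = tperm c b @: x i.
  apply: (neutral_maskin (P := P)) => // l S.
  case: (eqVneq l i) => [->|li] xS.
    apply: lift; first by rewrite !cardp (prefers_leq_card xS).
    by rewrite /score eqxx (inj_eq (injp _)) (negbTE (ne _ _ xS)) eqxx; case: eqP.
  case: (eqVneq l j) xS li => [->|lj] xS li; last by apply: other => //; apply: fix_b_c.
  apply: lift; first by rewrite !cardp (prefers_leq_card xS).
  rewrite /score (negbTE li) eqxx (inj_eq (injp _)) (negbTE (ne _ _ xS)) eqxx.
  have /negbTE Sne : S != tperm b a @: x j by apply: contraTneq xS => ->; rewrite prefers_asym.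
  by rewrite -[in X in X < _]fix_z (inj_eq (injp _)) Sne addn1.
have Xz : X Qf i = tperm b a @: x i.
  apply: (neutral_maskin (P := P)) => // l S.
  case: (eqVneq l i) => [->|li] xS.
    apply: lift; first by rewrite !cardp (prefers_leq_card xS).
    rewrite /score eqxx (inj_eq (injp _)) (negbTE (ne _ _ xS)) eqxx.
    have /negbTE Sne : S != tperm c b @: x i by apply: contraTneq xS => ->; rewrite prefers_asym.
    by rewrite -[in X in X < _]fix_y (inj_eq (injp _)) Sne addn1.
  case: (eqVneq l j) xS li => [->|lj] xS li; last by apply: other => //; apply: fix_a_b.
  apply: lift; first by rewrite !cardp (prefers_leq_card xS).
  by rewrite /score (negbTE li) eqxx (inj_eq (injp _)) (negbTE (ne _ _ xS)) eqxx; case: eqP.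
have : a \in tperm b a @: x i by rewrite -Xz Xy imset_tperm // !inE ac ai orbT.
by rewrite tpermC imset_tperm // !inE eqxx (negbTE ab).
Qed.

(** * Consecutive blocks under a common lexicographic preference *)

(** Smaller rank means a better good in the lexicographic preference below. *)
Definition rank (M : finType) (g : M) : nat := enum_rank g.

Lemma rank_inj (M : finType) : injective (@rank M).
Proof. by move=> g h /val_inj/enum_rank_inj. Qed.

Lemma rank_lt (M : finType) (g : M) : rank g < #|M|.
Proof. exact: ltn_ord. Qed.

Lemma lex_pref_ex (M : finType) : exists p : pref M,
  (forall (S : {set M}) b c, c \in S -> b \notin S -> rank b < rank c ->
     prefers p (tperm c b @: S) S) /\
  (forall (S T : {set M}) e, #|S| = #|T| -> e \in S ->
     (forall g, g \in T -> rank e < rank g) -> prefers p S T).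
Proof.
(* The base exceeds the size of every bundle, so one good outweighs any set of worse goods. *)
pose N := #|M|.+1; pose weight (g : M) := N ^ (#|M| - rank g).
have [p pP] := pref_of_score (fun S : {set M} => \sum_(g in S) weight g).
exists p; split=> [S b c cS bS bc | S T e ST eS eT]; apply: pP => //.
- by rewrite card_imset //; apply: perm_inj.
- rewrite imset_tperm // (big_setD1 c) //= big_setU1 ?inE ?(negbTE bS) ?andbF //=.
  rewrite ltn_add2r ltn_exp2l; last by rewrite ltnS; apply/card_gt0P; exists b.
  by have := rank_lt c; lia.
- have TN : (\sum_(g in T) weight g) * N <= #|T| * weight e.
    rewrite -sum_nat_const big_distrl /=; apply: leq_sum => g /eT eg.
    rewrite -expnSr leq_pexp2l //.
    by have := rank_lt g; lia.
  have eN : 0 < weight e by rewrite expn_gt0.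
  have eS_le : weight e <= \sum_(g in S) weight g by rewrite (big_setD1 e) //= leq_addr.
  apply: leq_trans eS_le; rewrite -(ltn_pmul2r (ltn0Sn #|M|)).
  apply: leq_ltn_trans TN _; rewrite mulnC ltn_pmul2l // ltnS.
  exact: max_card.
Qed.

Lemma sorting_perm (n : nat) (key : 'I_n -> nat) :
  exists s : {perm 'I_n}, forall u v : 'I_n, u < v -> key (s u) <= key (s v).
Proof.
pose le i j := key i <= key j.
have le_total : total le by move=> i j; apply: leq_total.
have le_trans : transitive le by move=> j i k; apply: leq_trans.
have /tuple_permP[s sE] : perm_eq (sort_tuple le (ord_tuple n)) (ord_tuple n).
  by rewrite perm_sort.
exists s => u v uv.
have nthE (w : 'I_n) : nth u (sort le (ord_tuple n)) w = s w.
  by rewrite -[RHS]tnth_ord_tuple -(tnth_mktuple (fun i => tnth (ord_tuple n) (s i)))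
             (tnth_nth u) -sE.
rewrite -!nthE; apply: (sorted_ltn_nth le_trans) uv; first exact: sort_sorted.
  by rewrite inE size_sort size_tuple.
by rewrite inE size_sort size_tuple.
Qed.

(** A deviation from the claimed value at one position, spread by monotonicity and the gap of at
    most one, bounds all of [q] by a step function [c + (d <= t)] whose sum is incompatible with
    [k * n + r]. *)
Lemma balanced_quotas (n k r : nat) (q : 'I_n -> nat) :
  (forall u v : 'I_n, u < v -> q u <= q v) ->
  (forall u v, q v <= (q u).+1) ->
  \sum_t q t = k * n + r -> r < n ->
  (forall t : 'I_n, t < n - r -> q t = k) /\
  (forall t : 'I_n, n - r <= t -> q t = k.+1).
Proof.
move=> mono near sum_q rn.
have mono_le (u v : 'I_n) : u <= v -> q u <= q v.
  by rewrite leq_eqVlt => /orP[/eqP/val_inj->|/mono].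
have sum_tail (c d : nat) : d <= n -> \sum_(t < n) (c + (d <= t)) = c * n + (n - d).
  move=> dn; rewrite big_split /= sum_nat_const card_ord mulnC; congr (_ + _).
  rewrite -[LHS](big_mkord xpredT (fun t => d <= t : nat)) (big_cat_nat (leq0n d) dn) /=.
  rewrite big_nat big1 => [|t /andP[_ td]]; last by rewrite leqNgt td.
  rewrite big_nat (eq_bigr (fun=> 1)) => [|t /andP[-> _]] //.
  by rewrite -big_nat sum_nat_const_nat muln1.
have lower c (d : nat) : d <= n -> (forall u : 'I_n, c + (d <= u) <= q u) ->
    c * n + (n - d) <= k * n + r.
  by move=> dn le_q; rewrite -sum_q -sum_tail //; apply: leq_sum.
have upper c (d : nat) : d <= n -> (forall u : 'I_n, q u <= c + (d <= u)) ->
    k * n + r <= c * n + (n - d).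
  by move=> dn le_q; rewrite -sum_q -sum_tail //; apply: leq_sum.
split=> t tr.
- apply/eqP; rewrite eqn_leq; apply/andP; split; rewrite leqNgt; apply/negP => qt.
  + have : k * n + (n - t) <= k * n + r.
      apply: lower => [|u]; first exact: ltnW.
      by case: (leqP t u) => [/mono_le|_]; have := near u t; lia.
    lia.
  + have : k * n + r <= k.-1 * n + (n - t.+1).
      apply: upper => [|u]; first exact: ltn_ord.
      by case: (ltnP t u) => [_|/mono_le]; have := near t u; lia.
    have := ltn_ord t; nia.
- apply/eqP; rewrite eqn_leq; apply/andP; split; rewrite leqNgt; apply/negP => qt.
  (* A quota of at least [k + 2] forces every quota to be at least [k + 1]; the choice [d = n]
     removes the step. *)
  + have : k.+1 * n + (n - n) <= k * n + r.
      apply: lower => // u; have := near u t; have := ltn_ord u; lia.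
    nia.
  + have : k * n + r <= k * n + (n - t.+1).
      apply: upper => [|u]; first exact: ltn_ord.
      by case: (ltnP t u) => [_|/mono_le]; have := near t u; lia.
    have := ltn_ord t; lia.
Qed.

Lemma no_interleaving (n : nat) (M : finType) (X : mechanism n M) (p : pref M)
    (i j : 'I_n) (a b c : M) :
  truthful X -> non_bossy X -> neutral X ->
  (forall (S : {set M}) b c, c \in S -> b \notin S -> rank b < rank c ->
     prefers p (tperm c b @: S) S) ->
  i != j -> a \in X [ffun=> p] i -> c \in X [ffun=> p] i ->
  b \in X [ffun=> p] j -> rank a < rank b -> rank b < rank c -> False.
Proof.
move=> tX nbX ntX swap ij ai ci bj ab bc.
apply: (no_double_swap tX nbX ntX ij ai ci bj); rewrite ?ffunE.
- by apply: contraTneq (ltn_trans ab bc) => ->; rewrite ltnn.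
- apply: swap => //; apply: contraNN ij => bi; apply/eqP; exact: bundle_inj bi bj.
- apply: swap => //; apply: contraNN ij => aj; apply/eqP; exact: bundle_inj ai aj.
Qed.

(** Agents are sorted by their worst good. A good of a later agent ranked above one of an earlier
    agent would interleave, since the later agent also owns a still worse good. *)
Lemma consecutive_blocks (n : nat) (M : finType) (X : mechanism n M) (p : pref M) :
  truthful X -> non_bossy X -> neutral X ->
  (forall (S : {set M}) b c, c \in S -> b \notin S -> rank b < rank c ->
     prefers p (tperm c b @: S) S) ->
  exists s : {perm 'I_n}, forall u v : 'I_n, u < v ->
    (X [ffun=> p] (s v) = set0 -> X [ffun=> p] (s u) = set0) /\
    (forall a g, a \in X [ffun=> p] (s u) -> g \in X [ffun=> p] (s v) ->
       rank a < rank g).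
Proof.
move=> tX nbX ntX swap; set A := X _.
(* The successor separates an empty bundle, of key 0, from one whose only good has rank 0; empty
   bundles thus come first. *)
pose key i := \max_(g in A i) (rank g).+1.
have rank_key i g : g \in A i -> rank g < key i.
  by move=> gi; exact: (bigmax_sup g).
have [s s_sorted] := sorting_perm key.
exists s => u v uv; have key_le := s_sorted u v uv.
split=> [Av0|a g au gv].
  apply/eqP; apply: contraTT key_le => /set0Pn[a au].
  by rewrite [key (s v)]big1 ?leqn0 -?lt0n ?(leq_trans _ (rank_key _ _ au)) // => g;
    rewrite Av0 inE.
have suv : s u != s v by rewrite (inj_eq perm_inj) -val_eqE /= ltn_eqF.
have ne b h : b \in A (s u) -> h \in A (s v) -> rank b <> rank h.
  by move=> bu hv /rank_inj bh; rewrite bh in bu; rewrite (bundle_inj bu hv) eqxx in suv.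
have [h hv keyE] : {h | h \in A (s v) & key (s v) = (rank h).+1}.
  by apply: eq_bigmax_cond; apply/card_gt0P; exists g.
have ah : rank a < rank h.
  by have := rank_key _ _ au; have := ne _ _ au hv; lia.
have [//|ga|/(ne _ _ au gv)//] := ltngtP (rank a) (rank g).
by rewrite eq_sym in suv; case: (no_interleaving tX nbX ntX swap suv gv hv au ga ah).
Qed.

(** * From the axioms to a serial dictatorship *)

Lemma sd_of_axioms (n : nat) (M : finType) (X : mechanism n M) :
  truthful X -> non_bossy X -> neutral X -> EFX X ->
  exists (s : {perm 'I_n}) (q : 'I_n -> nat),
    [/\ serial_dictatorship s q X, forall u v : 'I_n, u < v -> q u <= q v
      & forall u v, q v <= (q u).+1].
Proof.
move=> tX nbX ntX efxX.
have [p [swap lex]] := lex_pref_ex M.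
have [s blocks] := consecutive_blocks tX nbX ntX swap.
set A := X _ in blocks; pose q t := #|A (s t)|.
have injp (f : {perm M}) := imset_inj (@perm_inj _ f).
have cardp (f : {perm M}) (S : {set M}) : #|f @: S| = #|S|.
  by rewrite card_imset //; apply: perm_inj.
have efx i j g : g \in A j -> wprefers p (A i) (A j :\ g).
  by move=> gj; have := efxX [ffun=> p] i j g gj; rewrite ffunE.
exists s, q; split; last first.
- move=> u v; rewrite /q; have [->|/set0Pn[g gv]] := eqVneq (A (s v)) set0.
    by rewrite cards0.
  by rewrite (cardsD1 g) gv ltnS (wprefers_leq_card (efx _ _ _ gv)).
(* If the later block were smaller, removing one good from the earlier block would leave, by EFX, a
   bundle of equal size made of better goods, which the later agent would envy. *)
- move=> u v uv; have [empty before] := blocks u v uv.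
  rewrite leqNgt; apply/negP => vu.
  have [g gu] : exists g, g \in A (s u) by apply/card_gt0P; apply: leq_ltn_trans vu.
  have vug := efx (s v) _ g gu; have := wprefers_leq_card vug.
  rewrite /q (cardsD1 g (A (s u))) gu ltnS in vu => uv_card.
  have cardE : #|A (s u) :\ g| = #|A (s v)| by apply/eqP; rewrite eqn_leq uv_card.
  have [Av0|/set0Pn[h hv]] := eqVneq (A (s v)) set0.
    by rewrite (empty Av0) inE in gu.
  have /card_gt0P[e eu] : 0 < #|A (s u) :\ g| by rewrite cardE; apply/card_gt0P; exists h.
  have uvg : prefers p (A (s u) :\ g) (A (s v)).
    apply: (lex _ _ e) => // f; apply: before.
    by case/setD1P: eu.
  case/orP: vug => [|/eqP vE]; first by rewrite prefers_asym.
  by rewrite vE prefers_irr in uvg.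
split; first by rewrite -(sum_card_bundle A) [RHS](reindex_inj (@perm_inj _ s)).
move=> P.
(* [f] carries the blocks of [A] to the bundles picked at [P] by the first [t]
   agents; correct it one pick at a time. *)
have picks k : k <= n -> exists f : {perm M}, forall u : 'I_n, u < k ->
    most_preferred (P (s u)) (~: (\bigcup_(v < n | v < u) (f @: A (s v)))) (q u)
      (f @: A (s u)).
  elim: k => [|t IHt] tn; first by exists 1%g.
  have [f fP] := IHt (ltnW tn); set T := Ordinal tn.
  pose F := ~: (\bigcup_(v < n | v < T) (f @: A (s v))).
  have remaining (u : 'I_n) : T <= u -> f @: A (s u) \subset F.
    move=> Tu; apply/subsetP => _ /imsetP[g gu ->]; rewrite inE.
    apply/bigcupP => -[v vT]; rewrite mem_imset; last exact: perm_inj.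
    by move/(bundle_inj gu)/perm_inj => uv; rewrite -uv ltnNge Tu in vT.
  have [B [BF Bq Bbest]] : exists B, most_preferred (P (s T)) F (q T) B.
    rewrite /q -(cardp f); apply: most_preferred_ex; exact: remaining.
  (* The correction moves only goods still available, so the earlier picks survive. *)
  have [h hF hB] : exists2 h : {perm M}, perm_on F h & h @: (f @: A (s T)) = B.
    by apply: ex_perm_imset; rewrite ?remaining // cardp Bq.
  exists (f * h)%g.
  have fhE (S : {set M}) : (f * h)%g @: S = h @: (f @: S).
    by rewrite -imset_comp; apply: eq_imset => x; rewrite /= permM.
  have early (u : 'I_n) : u < t -> (f * h)%g @: A (s u) = f @: A (s u).
    move=> ut; rewrite fhE -[RHS]imset_id; apply: eq_in_imset => g gu.
    by apply: (out_perm hF); rewrite inE negbK; apply/bigcupP; exists u.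
  have earlyF (u : 'I_n) : u <= t -> \bigcup_(v < n | v < u) ((f * h)%g @: A (s v))
      = \bigcup_(v < n | v < u) (f @: A (s v)).
    by move=> ut; apply: eq_bigr => v vu; rewrite early // (leq_trans vu).
  move=> u; rewrite ltnS leq_eqVlt => /orP[/eqP uT|ut].
    have -> : u = T by apply: val_inj.
    by rewrite earlyF // fhE hB.
  by rewrite early // earlyF ?(ltnW ut) //; apply: fP.
have [f fP] := picks n (leqnn n).
have XE : forall i, X P i = f @: A i.
  apply: (neutral_maskin (P := [ffun=> p])) => // i S; rewrite ffunE -/A.
  rewrite -[i](permKV s); move: (_ i) => t AS.
  have [sub cardE best] := fP t (ltn_ord t).
  have := prefers_leq_card AS; rewrite leq_eqVlt => /orP[/eqP ScardE|SA]; last first.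
    by apply: prefers_card; rewrite !cardp.
  (* If [f @: S] avoids the earlier picks, the pick at [t] beats it. Otherwise [S] meets an earlier
     block, and the lexicographic order puts [S] above [A (s t)], against [AS]. *)
  have [fS|/subsetPn[_ /imsetP[e eS ->]]] :=
    boolP (f @: S \subset ~: (\bigcup_(v < n | v < t) (f @: A (s v)))).
    have /orP[//|/eqP/injp AeS] := best _ fS (etrans (cardp f S) ScardE).
    by rewrite AeS prefers_irr in AS.
  rewrite inE negbK => /bigcupP[v vt]; rewrite mem_imset; last exact: perm_inj.
  have [_ before] := blocks v t vt => ev; move: AS; rewrite prefers_asym //.
  by apply: (lex _ _ e) => // g; apply: before.
move=> t; have [sub cardE best] := fP t (ltn_ord t).
by rewrite XE (eq_bigr _ (fun u _ => XE (s u))).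
Qed.

Theorem theorem5 (n : nat) (M : finType) (m k r : nat)
    (hn : 1 <= n) (hM : #|M| = m)
    (hm : m = k * n + r) (hk : k = m %/ n) (hr : r < n)
    (X : mechanism n M) :
  (EFX X /\ pareto_optimal X /\ truthful X /\ non_bossy X /\ neutral X) <->
  (exists (s : {perm 'I_n}) (q : 'I_n -> nat),
     serial_dictatorship s q X /\
     (forall t : 'I_n, t < n - r -> q t = m %/ n) /\
     (forall t : 'I_n, n - r <= t -> q t = m %/ n + 1)).
Proof.
rewrite -hk; split=> [[efxX [_ [tX [nbX ntX]]]]|[s [q [sdX [qlo qhi]]]]].
  have [s [q [sdX mono near]]] := sd_of_axioms tX nbX ntX efxX.
  have sum_q : \sum_t q t = k * n + r by have [->] := sdX; rewrite hM.
  have [qlo qhi] := balanced_quotas mono near sum_q hr.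
  by exists s, q; split; last split=> // t /qhi; rewrite ?addn1.
split; first by apply: (sd_EFX sdX qlo) => t /qhi; rewrite addn1.
split; first exact: sd_pareto_optimal sdX.
split; first exact: sd_truthful sdX.
by split; [apply: sd_non_bossy sdX | apply: sd_neutral sdX].
Qed.
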